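(* Let $S$ be an idempotent semiring. The weak interval extension $I(S)$ of $S$ is closed with respect to the operations $\overline\oplus$, $\overline\odot$ and forms an idempotent semiring.
   Context: A semiring is a set $S$ with an associative commutative addition $\oplus$ and an associative multiplication $\odot$ that distributes over $\oplus$ on both sides; it is idempotent if $x\oplus x=x$ for all $x$ (zero and unity are not required). Canonical order: $x\preccurlyeq y$ iff $x\oplus y=y$. A closed interval in $S$ is $\mathbf x=[\underline{\mathbf x},\overline{\mathbf x}]=\{t\in S:\underline{\mathbf x}\preccurlyeq t\preccurlyeq\overline{\mathbf x}\}$ with $\underline{\mathbf x}\preccurlyeq\overline{\mathbf x}$. The weak interval extension $I(S)$ is the set of all closed intervals in $S$ equipped with the operations $\mathbf x\,\overline\star\,\mathbf y=[\underline{\mathbf x}\star\underline{\mathbf y},\overline{\mathbf x}\star\overline{\mathbf y}]$, where $\star$ denotes $\oplus$ or $\odot$. *)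

(* Defs.v *)
From mathcomp Require Import all_boot.
From mathcomp Require Import boolp classical_sets.

Set Implicit Arguments.
Unset Strict Implicit.
Unset Printing Implicit Defensive.

Local Open Scope classical_set_scope.

(* Neither a zero nor a unity is required, so the semiring structures of the
   ssralg hierarchy do not apply. *)
Record idempotent_semiring (S : Type) (add mul : S -> S -> S) : Prop :=
  IdempotentSemiring {
    isr_addA : associative add;
    isr_addC : commutative add;
    isr_mulA : associative mul;
    isr_mulDl : left_distributive mul add;
    isr_mulDr : right_distributive mul add;
    isr_addxx : idempotent_op add
  }.

Definition canonical_le (S : Type) (add : S -> S -> S) (x y : S) : Prop :=
  add x y = y.

Definition closed_itv (S : Type) (add : S -> S -> S) (a b : S) : set S :=
  [set t | canonical_le add a t /\ canonical_le add t b].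

Definition is_closed_itv (S : Type) (add : S -> S -> S) (X : set S) : Prop :=
  exists p : S * S, canonical_le add p.1 p.2 /\ X = closed_itv add p.1 p.2.

(* The elements of I(S) are subsets of S, not pairs of endpoints. *)
Definition weak_itv_ext (S : Type) (add : S -> S -> S) : Type :=
  {X : set S | is_closed_itv add X}.

(* When [add] is associative, commutative and idempotent, [canonical_le add] is
   a partial order, so the endpoints of a closed interval are its least and
   greatest elements; they are unique and [cid] makes no arbitrary choice. *)
Definition endpoints (S : Type) (add : S -> S -> S)
  (x : weak_itv_ext add) : S * S := sval (cid (svalP x)).

Definition lower (S : Type) (add : S -> S -> S) (x : weak_itv_ext add) : S :=
  (endpoints x).1.

Definition upper (S : Type) (add : S -> S -> S) (x : weak_itv_ext add) : S :=
  (endpoints x).2.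

(* This is only a subset of S: that it is again a closed interval depends on
   the semiring axioms. *)
Definition weak_op (S : Type) (add op : S -> S -> S)
  (x y : weak_itv_ext add) : set S :=
  closed_itv add (op (lower x) (lower y)) (op (upper x) (upper y)).

(* Main.v *)
Require Import Defs.
From mathcomp Require Import all_boot.
From mathcomp Require Import boolp classical_sets.

(** A closed interval has a least and a greatest element, namely its endpoints,
    so the pair of endpoints embeds I(S) into S x S ([itv_inj], [endpointsE]).
    Both semiring operations are monotone for the canonical order ([add_le],
    [mul_le]); hence they send pairs of ordered endpoints to ordered endpoints.
    This gives closure, and it also shows that the embedding turns the interval
    operations into the componentwise operations of S x S ([lower_itv_op],
    [upper_itv_op]). Every axiom of an idempotent semiring is an identity, so
    it passes from S to S x S and then to I(S). *)

Lemma canonical_le_refl {S : Type} {add mul : S -> S -> S}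
    (hS : idempotent_semiring add mul) (x : S) : canonical_le add x x.
Proof. exact: (isr_addxx hS). Qed.

Lemma canonical_le_anti {S : Type} {add mul : S -> S -> S}
    (hS : idempotent_semiring add mul) (x y : S) :
  canonical_le add x y -> canonical_le add y x -> x = y.
Proof. by move=> xy yx; rewrite -yx (isr_addC hS) xy. Qed.

Lemma canonical_le_trans {S : Type} {add mul : S -> S -> S}
    (hS : idempotent_semiring add mul) (y x z : S) :
  canonical_le add x y -> canonical_le add y z -> canonical_le add x z.
Proof.
by rewrite /canonical_le => xy yz; rewrite -yz (isr_addA hS) xy.
Qed.

Definition monotone_op {S : Type} (add op : S -> S -> S) : Prop :=
  forall x x' y y', canonical_le add x x' -> canonical_le add y y' ->
  canonical_le add (op x y) (op x' y').

Lemma add_le {S : Type} {add mul : S -> S -> S}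
  (hS : idempotent_semiring add mul) : monotone_op add add.
Proof.
move=> x x' y y' xx' yy'; rewrite /canonical_le -(isr_addA hS) (isr_addC hS y).
by rewrite -(isr_addA hS x') (isr_addC hS y') yy' (isr_addA hS) xx'.
Qed.

(** Distributivity turns x + x' = x' into xy + x'y = x'y, and similarly on the
    right, so the two factors can be increased one after the other. *)
Lemma mul_le {S : Type} {add mul : S -> S -> S}
  (hS : idempotent_semiring add mul) : monotone_op add mul.
Proof.
move=> x x' y y' xx' yy'; apply: (canonical_le_trans hS (mul x' y)).
  by rewrite /canonical_le -(isr_mulDl hS) xx'.
by rewrite /canonical_le -(isr_mulDr hS) yy'.
Qed.

Lemma lower_le_upper {S : Type} {add : S -> S -> S} (x : weak_itv_ext add) :
  canonical_le add (lower x) (upper x).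
Proof. by rewrite /lower /upper /endpoints; case: cid => p []. Qed.

Lemma weak_itv_extE {S : Type} {add : S -> S -> S} (x : weak_itv_ext add) :
  sval x = closed_itv add (lower x) (upper x).
Proof. by rewrite /lower /upper /endpoints; case: cid => p []. Qed.

(** Each of the two pairs of endpoints lies in the interval, hence within the
    bounds given by the other pair; antisymmetry then identifies them. *)
Lemma closed_itv_inj {S : Type} {add mul : S -> S -> S}
    (hS : idempotent_semiring add mul) (a b c d : S) :
  canonical_le add a b -> canonical_le add c d ->
  closed_itv add a b = closed_itv add c d -> a = c /\ b = d.
Proof.
move=> ab cd E; have rfl := canonical_le_refl hS.
have [ca _] : closed_itv add c d a by rewrite -E; split.
have [_ bd] : closed_itv add c d b by rewrite -E; split.
have [ac _] : closed_itv add a b c by rewrite E; split.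
have [_ db] : closed_itv add a b d by rewrite E; split.
by split; apply: (canonical_le_anti hS).
Qed.

Lemma endpointsE {S : Type} {add mul : S -> S -> S}
    (hS : idempotent_semiring add mul) (x : weak_itv_ext add) (a b : S) :
  canonical_le add a b -> sval x = closed_itv add a b ->
  lower x = a /\ upper x = b.
Proof.
move=> ab; rewrite weak_itv_extE.
exact: (closed_itv_inj hS _ _ _ _ (lower_le_upper x) ab).
Qed.

Lemma itv_inj {S : Type} {add : S -> S -> S} (x y : weak_itv_ext add) :
  lower x = lower y -> upper x = upper y -> x = y.
Proof.
move=> l u; have : sval x = sval y by rewrite !weak_itv_extE l u.
case: x y {l u} => [X hX] [Y hY] /= E; rewrite E in hX *.
by rewrite (Prop_irrelevance hX hY).
Qed.

Lemma weak_op_closed {S : Type} {add op : S -> S -> S}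
    (hop : monotone_op add op) (x y : weak_itv_ext add) :
  is_closed_itv add (weak_op op x y).
Proof.
exists (op (lower x) (lower y), op (upper x) (upper y)); split=> //.
by apply: hop; apply: lower_le_upper.
Qed.

Definition itv_op {S : Type} {add op : S -> S -> S}
    (hop : monotone_op add op) (x y : weak_itv_ext add) : weak_itv_ext add :=
  exist (is_closed_itv add) (weak_op op x y) (weak_op_closed hop x y).

Lemma lower_itv_op {S : Type} {add mul op : S -> S -> S}
    (hS : idempotent_semiring add mul) (hop : monotone_op add op)
    (x y : weak_itv_ext add) :
  lower (itv_op hop x y) = op (lower x) (lower y).
Proof.
by case: (endpointsE hS (itv_op hop x y) _ _
  (hop _ _ _ _ (lower_le_upper x) (lower_le_upper y)) erefl).
Qed.

Lemma upper_itv_op {S : Type} {add mul op : S -> S -> S}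
    (hS : idempotent_semiring add mul) (hop : monotone_op add op)
    (x y : weak_itv_ext add) :
  upper (itv_op hop x y) = op (upper x) (upper y).
Proof.
by case: (endpointsE hS (itv_op hop x y) _ _
  (hop _ _ _ _ (lower_le_upper x) (lower_le_upper y)) erefl).
Qed.

Theorem proposition2 (S : Type) (add mul : S -> S -> S)
    (hS : idempotent_semiring add mul) :
  exists (add_closed : forall x y : weak_itv_ext add,
            is_closed_itv add (weak_op add x y))
         (mul_closed : forall x y : weak_itv_ext add,
            is_closed_itv add (weak_op mul x y)),
    idempotent_semiring
      (fun x y : weak_itv_ext add =>
         exist (is_closed_itv add) (weak_op add x y) (add_closed x y))
      (fun x y : weak_itv_ext add =>
         exist (is_closed_itv add) (weak_op mul x y) (mul_closed x y)).
Proof.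
exists (weak_op_closed (add_le hS)), (weak_op_closed (mul_le hS)).
change (idempotent_semiring (itv_op (add_le hS)) (itv_op (mul_le hS))).
have loE := fun op => @lower_itv_op S add mul op hS.
have upE := fun op => @upper_itv_op S add mul op hS.
by split=> [x y z|x y|x y z|x y z|x y z|x]; apply: itv_inj; rewrite ?loE ?upE;
  first [ exact: (isr_addA hS) | exact: (isr_addC hS) | exact: (isr_mulA hS)
        | exact: (isr_mulDl hS) | exact: (isr_mulDr hS)
        | exact: (isr_addxx hS)].
Qed.
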